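(* Let $\mathcal{G}$ be an irreducible matrix product system and let $\mathcal{P}$ be its set of periodic paths. Then the set $\{\lambda(\gamma):\gamma\in\mathcal{P}\}$ of Lyapunov exponents of periodic paths is dense in $[\alpha_{\min},\alpha_{\max}]$.
   Context: A (graph-directed) matrix product system $\mathcal{G}$ consists of a finite strongly connected directed graph $G$ (loops and parallel edges allowed) with vertex set $V(G)$ and edge set $E(G)$; a dimension $d(v)\in\mathbb{N}=\{1,2,\ldots\}$ for each vertex $v$; and, for each edge $e$ from $v_1$ to $v_2$, a $d(v_1)\times d(v_2)$ matrix $T(e)$ with non-negative real entries and a weight $W(e)\in(0,1)$. $\Sigma$ is the set of all infinite paths $(e_i)_{i=1}^\infty$ in $G$ and $\Sigma^*$ is the set of all finite paths in $G$. For $\eta=(e_1,\ldots,e_n)\in\Sigma^*$ with $n\ge1$ put $T(\eta)=T(e_1)\cdots T(e_n)$, $W(\eta)=W(e_1)\cdots W(e_n)$ and $\eta^-=(e_1,\ldots,e_{n-1})$; the empty path has $W=1$. $\gamma|n$ is the prefix of length $n$ of $\gamma\in\Sigma$. For a non-negative matrix $M$, $\|M\|=\sum_{i,j}M_{i,j}$. $\mathcal{G}$ is irreducible if there is a finite family $\mathcal{H}\subset\Sigma^*$ of paths (each with at least one edge) such that for any vertices $v_1,v_2$ and any $1\le i\le d(v_1)$, $1\le j\le d(v_2)$, there is a path $\gamma\in\mathcal{H}$ from $v_1$ to $v_2$ with $T(\gamma)_{i,j}>0$. For $t>0$, $\Sigma_t=\{\eta\in\Sigma^*: W(\eta)<t\le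 W(\eta^-),\ \|T(\eta)\|>0\}$. Define $$\alpha_{\min}=\lim_{t\to0}\min_{\eta\in\Sigma_t}\frac{\log\|T(\eta)\|}{\log t},\qquad \alpha_{\max}=\lim_{t\to0}\max_{\eta\in\Sigma_t}\frac{\log\|T(\eta)\|}{\log t};$$ for irreducible $\mathcal{G}$ these limits exist and are real. For $\gamma\in\Sigma$, the Lyapunov exponent is $\lambda(\gamma)=\lim_{n\to\infty}\frac{\log\|T(\gamma|n)\|}{\log W(\gamma|n)}$ when this limit exists. A cycle is a (non-empty) finite path beginning and ending at the same vertex. A periodic path is an element of $\Sigma$ of the form $(\theta,\theta,\ldots)$ with $\theta$ a cycle; the Lyapunov exponent of such a path always exists and is given by $\log\operatorname{sp}(T(\theta))/\log W(\theta)$, where $\operatorname{sp}$ denotes the spectral radius. *)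

(* Defs.v *)
From HB Require Import structures.
From mathcomp Require Import all_boot all_order all_algebra.
From mathcomp Require Import all_classical all_reals all_analysis.
Set Implicit Arguments.
Unset Strict Implicit.
Unset Printing Implicit Defensive.
Import Order.TTheory GRing.Theory Num.Theory.
Import numFieldNormedType.Exports.
Local Open Scope classical_set_scope.
Local Open Scope ring_scope.

Record digraph := Digraph {
  vertex : finType;
  edge : finType;
  src : edge -> vertex;
  tgt : edge -> vertex }.

Arguments src {d} _.
Arguments tgt {d} _.

(* [walk u v s]: the edge sequence [s] is a finite path from [u] to [v].
   The empty sequence is the empty path from any vertex to itself. *)
Fixpoint walk (G : digraph) (u v : vertex G) (s : seq (edge G)) : bool :=
  if s is e :: s' then (src e == u) && walk (tgt e) v s' else u == v.

(* Graphs have at least one vertex, as usual. *)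
Record mpsystem (R : realType) := MPSystem {
  graph :> digraph;
  dim : vertex graph -> nat;
  mx : forall e : edge graph, 'M[R]_(dim (src e), dim (tgt e));
  weight : edge graph -> R;
  vertex_gt0 : (0 < #|vertex graph|)%N;
  strongly_connected :
    forall u v : vertex graph, exists s : seq (edge graph), walk u v s;
  dim_gt0 : forall v, (0 < dim v)%N;
  mx_ge0 : forall e i j, 0 <= mx e i j;
  weight_itv : forall e, 0 < weight e < 1 }.

Arguments dim {R} _ _.
Arguments mx {R} _ _.
Arguments weight {R} _ _.

Section MatrixProducts.
Variables (R : realType) (G : mpsystem R).
Implicit Types (u v : vertex G) (s : seq (edge G)) (g : nat -> edge G).

(* T(s) for a finite path [s] from [u] to [v], which is the only case where
   this is used.  [conform_mx 0 A] is [A] when the dimensions agree, which they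
   do along a path; it replaces a cast along [src e = u] (see [pathmx_cons] and
   [pathmx_nil]). *)
Fixpoint pathmx u v s : 'M[R]_(dim G u, dim G v) :=
  if s is e :: s' then
    conform_mx (0 : 'M[R]_(dim G u, dim G (tgt e))) (mx G e) *m pathmx (tgt e) v s'
  else conform_mx 0 (1%:M : 'M[R]_(dim G u)).

Lemma pathmx_cons e v s :
  pathmx (src e) v (e :: s) = mx G e *m pathmx (tgt e) v s.
Proof. by rewrite /= conform_mx_id. Qed.

Lemma pathmx_nil v : pathmx v v [::] = 1%:M.
Proof. by rewrite /= conform_mx_id. Qed.

Definition pathweight s : R := \prod_(e <- s) weight G e.

Definition mxnorm1 m n (A : 'M[R]_(m, n)) : R := \sum_i \sum_j A i j.

Definition irreducible_system : Prop :=
  exists H : seq (seq (edge G)),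
    (forall s, s \in H -> s != [::] /\ exists u v, walk u v s) /\
    forall u v (i : 'I_(dim G u)) (j : 'I_(dim G v)),
      exists s, [/\ s \in H, walk u v s & 0 < pathmx u v s i j].

(* [Sigma_t t u v] is the set of the paths from [u] to [v] in Sigma_t;
   [take (size s).-1 s] is [s] without its last edge. *)
Definition Sigma_t (t : R) u v : set (seq (edge G)) :=
  [set s | [/\ s != [::], walk u v s,
               pathweight s < t <= pathweight (take (size s).-1 s)
             & 0 < mxnorm1 (pathmx u v s)]].

Definition log_ratios (t : R) : set R :=
  [set a | exists u v s,
     Sigma_t t u v s /\ a = ln (mxnorm1 (pathmx u v s)) / ln t].

(* Weights are bounded away from 1, so [log_ratios t] is finite, and for an
   irreducible system it is nonempty for small [t]: the infimum and supremum
   are then a minimum and a maximum. *)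
Definition alpha_min : R := lim (inf (log_ratios t) @[t --> 0^'+]).
Definition alpha_max : R := lim (sup (log_ratios t) @[t --> 0^'+]).

Definition infinite_path g : Prop := forall n, tgt (g n) = src (g n.+1).

(* The entry sum of T(g|n), where [mkseq g n] lists the first [n] edges. *)
Definition prefix_norm g n : R :=
  mxnorm1 (pathmx (src (g 0%N)) (src (g n)) (mkseq g n)).

(* The Lyapunov exponent of [g] exists and equals [l].  It is extended real: if
   T(g|n) = 0 from some point on, then [lne 0 = -oo] and the exponent is [+oo]. *)
Definition lyapunov g (l : \bar R) : Prop :=
  (lne (prefix_norm g n)%:E * ((ln (pathweight (mkseq g n)))^-1)%:E)%E
    @[n --> \oo] --> l.

Definition periodic g : Prop :=
  infinite_path g /\
  exists v (c : seq (edge G)), [/\ c != [::], walk v v c &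
    forall n, g n = nth (g 0%N) c (n %% size c)].

Definition periodic_exponents : set (\bar R) :=
  [set l | exists g, periodic g /\ lyapunov g l].

End MatrixProducts.

Arguments irreducible_system {R} G.
Arguments alpha_min {R} G.
Arguments alpha_max {R} G.
Arguments periodic_exponents {R} G.

(* [A] need not be contained in [X]: the set of periodic exponents may contain
   [+oo]. *)
Definition dense_in (T : topologicalType) (A X : set T) : Prop :=
  X `<=` closure (A `&` X).

(* Main.v *)
Require Import Defs.
From mathcomp Require Import all_boot all_order all_algebra.
From mathcomp Require Import all_classical all_reals all_analysis.
From mathcomp Require Import ring lra.
Import Order.TTheory GRing.Theory Num.Theory.
Import numFieldNormedType.Exports.
Local Open Scope classical_set_scope.
Local Open Scope ring_scope.

(** The proof compares, up to bounded errors, finite walks with periodic paths.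
    For a walk [s] put [lognorm s = - ln ||T(s)||] and
    [logweight s = - ln W(s)], and let [x = - ln t].

    Any two coordinates are linked by a walk from a finite list ([connector]).
    Hence walks can be joined ([join_paths]), with [lognorm] and [logweight]
    additive up to a constant: the norm of a product never exceeds the product
    of the norms, and linking the heaviest entries gives the opposite inequality.
    In the same way any walk [s] with [T(s)] nonzero closes up to a cycle, whose
    exponent [l] satisfies [|lognorm s - l * logweight s| <= K] for a constant
    [K] independent of [s] ([close_exponent]).  That the exponent of such a cycle
    exists is Fekete's lemma ([periodic_exponent_exists]).  Conversely, the
    periodic path with exponent [l] has a prefix in [Sigma_t] for every small
    [t], with [lognorm] close to [l * x] ([trace_path]).

    Consequently, as [t] tends to 0, every log ratio over [Sigma_t] is near an
    exponent and every exponent is near a log ratio.  So the limits [alpha_min]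
    and [alpha_max] exist and are the infimum and the supremum of the finite
    periodic exponents ([alpha_minE], [alpha_maxE]).

    It remains to fill the gap between two exponents [l1 < l2].  For [a]
    equal to [c * l1 + (1 - c) * l2], join a prefix of the first path, of
    logarithmic weight about [c * X], to a prefix of the second, of logarithmic
    weight about [(1 - c) * X], and close up.  The error in the exponent so
    obtained is small when [X] is large ([exponents_intermediate]). *)

Set Implicit Arguments.
Unset Strict Implicit.
Unset Printing Implicit Defensive.

(** * Non-negative matrices *)

Section Generalities.
Variable R : realType.

(** The source of the constants that depend on the system only: they bound
    something over its finitely many vertices, edges or matrix entries.  The
    monotonicity of [Q] makes the maximum of the individual bounds a common
    one. *)
Lemma fin_bound (T : finType) (Q : T -> R -> Prop) :
  (forall t a b, Q t a -> a <= b -> Q t b) -> (forall t, exists a, Q t a) ->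
  exists2 a, 1 <= a & forall t, Q t a.
Proof.
move=> mono /choice[f Qf]; exists (\big[Order.max/1]_t f t).
  exact: bigmax_ge_id.
by move=> t; apply: mono (Qf t) _; apply: le_bigmax.
Qed.

Section NonnegMatrices.
Context {m n p : nat}.
Implicit Types (A : 'M[R]_(m, n)) (B : 'M[R]_(n, p)).

Lemma le_entry_mulmx A B i k j : (forall i j, 0 <= A i j) ->
  (forall i j, 0 <= B i j) -> A i k * B k j <= (A *m B) i j.
Proof.
move=> A0 B0; rewrite mxE (bigD1 k)//= lerDl sumr_ge0// => l _.
exact: mulr_ge0.
Qed.

Lemma mxnorm1_ge0 A : (forall i j, 0 <= A i j) -> 0 <= mxnorm1 A.
Proof. by move=> A0; do 2 (apply: sumr_ge0 => ? _). Qed.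

Lemma le_entry_mxnorm1 A i j : (forall i j, 0 <= A i j) -> A i j <= mxnorm1 A.
Proof.
move=> A0; rewrite /mxnorm1 (bigD1 i)//= (bigD1 j)//= -addrA lerDl.
by apply: addr_ge0; do ?(apply: sumr_ge0 => ? _).
Qed.

(** A non-negative matrix is comparable to its largest entry, so that a bound on
    one well chosen entry of a product bounds its whole norm from below. *)
Lemma mxnorm1_entry A : 0 < mxnorm1 A ->
  exists i j, mxnorm1 A <= (m * n)%:R * A i j.
Proof.
move=> A0.
have [ij0 _|no] := pickP (fun _ : 'I_m * 'I_n => true); last first.
  suff : mxnorm1 A = 0 by move=> h; rewrite h ltxx in A0.
  by apply: big1 => i _; apply: big1 => j _; have := no (i, j).
case: (@arg_maxP _ _ _ ij0 xpredT (fun ij => A ij.1 ij.2) isT).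
move=> -[i j] /= _ hmax.
exists i, j; rewrite /mxnorm1 pair_bigA /=.
apply: (@le_trans _ _ (\sum_(q : 'I_m * 'I_n) A i j)).
  by apply: ler_sum => q _; apply: hmax.
by rewrite sumr_const card_prod !card_ord mulr_natl.
Qed.

Lemma mxnorm1_mulmx A B : (forall i j, 0 <= A i j) ->
  (forall i j, 0 <= B i j) -> mxnorm1 (A *m B) <= mxnorm1 A * mxnorm1 B.
Proof.
move=> A0 B0.
rewrite /mxnorm1 mulr_suml; apply: ler_sum => i _.
under eq_bigr do rewrite mxE.
rewrite exchange_big mulr_suml; apply: ler_sum => k _ /=.
rewrite -mulr_sumr; apply: ler_wpM2l => //.
by rewrite [leRHS](bigD1 k)//= lerDl; do 2 (apply: sumr_ge0 => ? _).
Qed.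

End NonnegMatrices.

End Generalities.

(** * Finite walks and their matrices *)

Section Walks.
Variable G : digraph.
Implicit Types (u v w : vertex G) (s : seq (edge G)).

Lemma walk_cat u w v s1 s2 :
  walk u w s1 -> walk w v s2 -> walk u v (s1 ++ s2).
Proof.
elim: s1 u => [|e s1 IH] u /=; first by move=> /eqP->.
by move=> /andP[-> h1] h2; apply: IH.
Qed.

End Walks.

Section Paths.
Variables (R : realType) (G : mpsystem R).
Implicit Types (u v w : vertex G) (s : seq (edge G)).

Definition pnorm u v s : R := mxnorm1 (pathmx u v s).

(** The minus signs make [logweight] non-negative and additive, and [lognorm]
    superadditive under concatenation; the ratio [lognorm / logweight] is the
    one in the definition of the exponents. *)
Definition lognorm u v s : R := - ln (pnorm u v s).
Definition logweight s : R := - ln (pathweight s).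

(** As [ln 0 = 0], the value of [lognorm] is meaningful on these walks only; the
    elements of [Sigma_t] are among them. *)
Definition alive u v s : bool := walk u v s && (0 < pnorm u v s).

Lemma pathmx_cat u w v s1 s2 : walk u w s1 -> walk w v s2 ->
  pathmx u v (s1 ++ s2) = pathmx u w s1 *m pathmx w v s2.
Proof.
elim: s1 u => [|e s1 IH] u.
  by move=> /eqP-> _; rewrite pathmx_nil mul1mx.
case/andP => /eqP <- h1 h2.
by rewrite cat_cons !pathmx_cons (IH _ h1 h2) mulmxA.
Qed.

Lemma pathmx_ge0 u v s : walk u v s -> forall i j, 0 <= pathmx u v s i j.
Proof.
elim: s u => [|e s IH] u.
  by move=> /eqP-> i j; rewrite pathmx_nil mxE ler0n.
case/andP => /eqP <- h1 i j.
rewrite pathmx_cons mxE sumr_ge0// => k _; apply: mulr_ge0; last exact: IH.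
exact: mx_ge0.
Qed.

Lemma pnorm_ge0 u v s : walk u v s -> 0 <= pnorm u v s.
Proof. by move=> h; apply: mxnorm1_ge0; exact: pathmx_ge0. Qed.

Lemma pnorm_cat u w v s1 s2 : walk u w s1 -> walk w v s2 ->
  pnorm u v (s1 ++ s2) <= pnorm u w s1 * pnorm w v s2.
Proof.
move=> h1 h2; rewrite /pnorm (pathmx_cat h1 h2).
by apply: mxnorm1_mulmx; exact: pathmx_ge0.
Qed.

(** Submultiplicativity of the norm.  Both halves of a walk with nonzero product
    have nonzero products, so prefixes of such walks may be taken freely. *)
Lemma alive_cat u w v s1 s2 : walk u w s1 -> walk w v s2 ->
  alive u v (s1 ++ s2) ->
  [/\ alive u w s1, alive w v s2 &
      lognorm u w s1 + lognorm w v s2 <= lognorm u v (s1 ++ s2)].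
Proof.
move=> h1 h2 /andP[_ h].
have le := pnorm_cat h1 h2.
have := lt_le_trans h le => h12.
have p1 : 0 < pnorm u w s1.
  rewrite lt_neqAle pnorm_ge0// andbT eq_sym; apply/eqP => h0.
  by rewrite h0 mul0r ltxx in h12.
have p2 : 0 < pnorm w v s2 by rewrite pmulr_rgt0 in h12.
rewrite /alive h1 h2 p1 p2; split => //.
by rewrite /lognorm -opprD lerN2 -lnM ?posrE// ler_ln ?posrE.
Qed.

Lemma pathweight_gt0 s : 0 < pathweight s.
Proof. by apply: prodr_gt0 => e _; have /andP[] := weight_itv e. Qed.

Lemma logweight_cat s1 s2 : logweight (s1 ++ s2) = logweight s1 + logweight s2.
Proof.
by rewrite /logweight /pathweight big_cat /= lnM ?posrE ?pathweight_gt0// opprD.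
Qed.

Lemma logweight_nil : logweight [::] = 0.
Proof. by rewrite /logweight /pathweight big_nil ln1 oppr0. Qed.

Lemma logweight_seq1 e : logweight [:: e] = - ln (weight G e).
Proof. by rewrite /logweight /pathweight big_seq1. Qed.

(** Edge weights lie in a compact subset of the open unit interval, hence
    [logweight] and length are comparable. *)
Lemma logweight_size :
  exists2 K : R, 1 <= K &
    forall s, (size s)%:R <= K * logweight s /\ logweight s <= K * (size s)%:R.
Proof.
have [K K1 HK] : exists2 K : R, 1 <= K &
    forall e : edge G, 1 <= K * logweight [:: e] /\ logweight [:: e] <= K.
  apply: fin_bound => [e a b|e].
    have : 0 <= logweight [:: e].
      have /andP[h1 h2] := weight_itv e.
      by rewrite logweight_seq1 oppr_ge0 ln_le0// ltW.
    move=> h [h1 h2] ab; split; last exact: le_trans ab.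
    by apply: le_trans h1 _; apply: ler_wpM2r.
  have h : 0 < logweight [:: e].
    have /andP[h1 h2] := weight_itv e.
    by rewrite logweight_seq1 oppr_gt0 ln_lt0// h1.
  exists (Num.max (logweight [:: e]) (logweight [:: e])^-1).
  split; last by rewrite le_max lexx.
  by rewrite -ler_pdivrMr// div1r le_max lexx orbT.
exists K => //; elim => [|e s [IH1 IH2]].
  by rewrite logweight_nil !mulr0.
have [h1 h2] := HK e.
by rewrite -cat1s logweight_cat size_cat/= natrD !mulrDr mulr1 !lerD.
Qed.

Lemma logweight_ge0 s : 0 <= logweight s.
Proof.
have [K K1 /(_ s)[h _]] := logweight_size.
by rewrite -(@pmulr_rge0 _ K) ?(lt_le_trans _ K1)// (le_trans _ h).
Qed.

Lemma pnorm_nil v : pnorm v v [::] = (Defs.dim G v)%:R.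
Proof.
rewrite /pnorm pathmx_nil /mxnorm1.
under eq_bigr => i _.
  rewrite (bigD1 i)//= big1 ?mxE ?eqxx ?addr0; last first.
    by move=> j /negPf ij; rewrite mxE eq_sym ij.
  over.
by rewrite sumr_const card_ord.
Qed.

Lemma alive_nil v : alive v v [::].
Proof. by rewrite /alive /= eqxx pnorm_nil ltr0n dim_gt0. Qed.

Lemma dim_le_expR :
  exists2 K : R, 1 <= K & forall v, (Defs.dim G v)%:R <= expR K.
Proof.
apply: fin_bound => [v a b h ab|v].
  by apply: le_trans h _; rewrite ler_expR.
exists (Defs.dim G v)%:R; apply: le_trans (expR_ge1Dx _).
by rewrite lerDr.
Qed.

Lemma pnorm_le : exists2 K : R, 1 <= K &
  forall u v s, walk u v s -> pnorm u v s <= expR (K * (size s).+1%:R).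
Proof.
have [D D1 HD] := dim_le_expR.
have [B B1 HB] : exists2 B : R, 1 <= B &
    forall e : edge G, mxnorm1 (mx G e) <= expR B.
  apply: fin_bound => [e a b h ab|e].
    by apply: le_trans h _; rewrite ler_expR.
  exists (mxnorm1 (mx G e)); apply: le_trans (expR_ge1Dx _).
  by rewrite lerDr.
exists (D + B) => [|u v s]; first lra.
elim: s u => [|e s IH] u.
  move=> /eqP->; rewrite pnorm_nil; apply: le_trans (HD v) _.
  by rewrite ler_expR /= mulr1; lra.
case/andP => /eqP <- h.
rewrite /pnorm pathmx_cons; apply: le_trans.
  by apply: mxnorm1_mulmx; [exact: mx_ge0|exact: pathmx_ge0].
apply: le_trans.
  by apply: ler_pM; [apply: mxnorm1_ge0; exact: mx_ge0|exact: pnorm_ge0|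
    exact: HB|exact: IH].
rewrite -expRD ler_expR/= [in leRHS]mulrS mulrDr mulr1; lra.
Qed.

(** A positive entry of the product is a sum of products of entries of the
    edge matrices, one of which is positive; so it is at least a power of the
    least positive entry of an edge matrix. *)
Lemma entry_ge : exists2 K : R, 1 <= K &
  forall u v s i j, walk u v s -> 0 < pathmx u v s i j ->
    expR (- (K * (size s)%:R)) <= pathmx u v s i j.
Proof.
have [B B1 HB] : exists2 B : R, 1 <= B &
    forall (e : edge G) i j, 0 < mx G e i j -> expR (- B) <= mx G e i j.
  apply: fin_bound => [e a b h ab i j h0|e].
    by apply: le_trans (h i j h0); rewrite ler_expR lerN2.
  have [||B B1 H] := @fin_bound R _ (fun ij b =>
      0 < mx G e ij.1 ij.2 -> expR (- b) <= mx G e ij.1 ij.2).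
  - move=> t a b h ab h0.
    by apply: le_trans (h h0); rewrite ler_expR lerN2.
  - move=> [i j]/=; exists (- ln (mx G e i j)) => h.
    by rewrite opprK lnK.
  by exists B => i j; exact: (H (i, j)).
exists B => // u v s; elim: s u => [|e s IH] u i j.
  move=> /eqP uv; subst u; rewrite pathmx_nil mxE mulr0 oppr0 expR0.
  by case: (i == j) => //; rewrite ltxx.
case/andP => /eqP eu; subst u => h.
rewrite pathmx_cons => h0.
have [k hk] : exists k, 0 < mx G e i k * pathmx (tgt e) v s k j.
  apply: contrapT => /forallNP no.
  suff : (mx G e *m pathmx (tgt e) v s) i j <= 0 by rewrite leNgt h0.
  rewrite mxE sumr_le0// => k _; rewrite leNgt; apply/negP; exact: no.
apply: le_trans (le_entry_mulmx i k j _ _); last 2 first.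
- exact: mx_ge0.
- exact: pathmx_ge0.
have h1 : 0 < mx G e i k.
  rewrite lt_neqAle mx_ge0 andbT eq_sym; apply/eqP => h1.
  by rewrite h1 mul0r ltxx in hk.
have h2 : 0 < pathmx (tgt e) v s k j by rewrite pmulr_rgt0 in hk.
rewrite /= mulrS mulrDr mulr1 opprD expRD.
by apply: ler_pM => //; [exact: HB|exact: IH].
Qed.

(** The upper bound on the norm is submultiplicativity; the lower bound is that
    nonzero products cannot be smaller than exponential in their length. *)
Lemma lognorm_bound : exists2 K : R, 1 <= K &
  forall u v s, alive u v s -> `|lognorm u v s| <= K * (logweight s + 1).
Proof.
have [K1 K11 H1] := pnorm_le.
have [K2 K21 H2] := entry_ge.
have [K3 K31 H3] := logweight_size.
exists (K1 * K3 + K2 * K3); first by nra.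
move=> u v s /andP[wlk s0].
have [h3 _] := H3 s.
have w0 := logweight_ge0 s.
have hle : - lognorm u v s <= K1 * (size s).+1%:R.
  by rewrite opprK -ler_expR lnK ?posrE// H1.
have hge : lognorm u v s <= K2 * (size s)%:R.
  rewrite -lerN2 opprK -ler_expR lnK ?posrE//.
  have [i [j hij]] := mxnorm1_entry s0.
  have hij0 : 0 < pathmx u v s i j.
    rewrite lt_neqAle pathmx_ge0// andbT eq_sym; apply/eqP => h0.
    by move: (lt_le_trans s0 hij); rewrite h0 mulr0 ltxx.
  apply: le_trans (H2 _ _ _ _ _ wlk hij0) _.
  by apply: le_entry_mxnorm1; exact: pathmx_ge0.
rewrite -natr1 mulrDr mulr1 in hle.
have e1 := ler_wpM2l (le_trans ler01 K11) h3.
have e2 := ler_wpM2l (le_trans ler01 K21) h3.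
have e3 := ler_wpM2l (le_trans ler01 K11) K31.
have e4 : 0 <= K3 * logweight s by apply: mulr_ge0; lra.
have e5 : 0 <= K2 * (K3 * logweight s) by apply: mulr_ge0; lra.
have e6 : 0 <= K1 * (K3 * logweight s) by apply: mulr_ge0; lra.
have e7 : 0 <= K2 * K3 by apply: mulr_ge0; lra.
rewrite ler_norml; apply/andP; split; lra.
Qed.

Lemma heavy_entry : exists2 K : R, 1 <= K &
  forall u v s, alive u v s ->
    exists i j, pnorm u v s <= expR K * pathmx u v s i j.
Proof.
have [D D1 HD] := dim_le_expR.
exists (D + D) => [|u v s /andP[wlk s0]]; first lra.
have [i [j hij]] := mxnorm1_entry s0; exists i, j.
apply: le_trans hij _; apply: ler_wpM2r; first exact: pathmx_ge0.
by rewrite expRD natrM ler_pM.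
Qed.

Hypothesis irr : irreducible_system G.

(** Irreducibility in the form in which it is used: any two coordinates are
    linked by a nonempty walk whose weight, norm and linking entry are
    controlled by one constant. *)
Lemma connector : exists2 K : R, 1 <= K &
  forall u v (i : 'I_(Defs.dim G u)) (j : 'I_(Defs.dim G v)), exists s,
    [/\ s != [::], walk u v s, logweight s <= K, pnorm u v s <= expR K &
        expR (- K) <= pathmx u v s i j].
Proof.
have [H [Hne HH]] := irr.
have mono u v (i : 'I_(Defs.dim G u)) (j : 'I_(Defs.dim G v)) s (a b : R) :
  [/\ s != [::], walk u v s, logweight s <= a, pnorm u v s <= expR a &
        expR (- a) <= pathmx u v s i j] -> a <= b ->
  [/\ s != [::], walk u v s, logweight s <= b, pnorm u v s <= expR b &
        expR (- b) <= pathmx u v s i j].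
  move=> [h1 h2 h3 h4 h5] ab; split => //.
  - exact: le_trans ab.
  - by apply: le_trans h4 _; rewrite ler_expR.
  - by apply: le_trans h5; rewrite ler_expR lerN2.
apply: fin_bound => [u a b h ab v i j|u].
  by have [s hs] := h v i j; exists s; apply: mono ab.
have [||K _ HK] := @fin_bound R _ (fun v a =>
  forall (i : 'I_(Defs.dim G u)) (j : 'I_(Defs.dim G v)), exists s,
    [/\ s != [::], walk u v s, logweight s <= a, pnorm u v s <= expR a &
        expR (- a) <= pathmx u v s i j]); last by exists K.
  move=> v a b h ab i j.
  by have [s hs] := h i j; exists s; apply: mono ab.
move=> v.
have [||K _ HK] := @fin_bound R _
  (fun (ij : 'I_(Defs.dim G u) * 'I_(Defs.dim G v)) a => exists s,
    [/\ s != [::], walk u v s, logweight s <= a, pnorm u v s <= expR a &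
        expR (- a) <= pathmx u v s ij.1 ij.2]); last first.
- by exists K => i j; have := HK (i, j).
- move=> [i j]/=; have [s [sH wlk s0]] := HH u v i j.
  have [s_ne _] := Hne _ sH.
  exists (Num.max (logweight s)
    (Num.max (pnorm u v s) (- ln (pathmx u v s i j)))).
  exists s; split => //.
  + by rewrite le_max lexx.
  + apply: (@le_trans _ _ (expR (pnorm u v s))).
      by apply: le_trans (expR_ge1Dx _); rewrite lerDr.
    by rewrite ler_expR !le_max lexx !orbT.
  + rewrite -[leRHS]lnK ?posrE// ler_expR lerNl !le_max lexx !orbT//.
- by move=> ij a b [s hs] ab; exists s; apply: mono ab.
Qed.

End Paths.


(** * Superadditive sequences *)

Section Fekete.
Variable R : realType.

(** Fekete's lemma, with [l] the supremum of [f n / n].  To compare [f n] with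
    [n * l], divide [n] by an [m] at which [f m / m] is within [e] of [l]; the
    remainders contribute only a constant.  The error is kept in the explicit
    form [n * e + C] because it is added to other errors of the same form
    later. *)
Lemma fekete (f : nat -> R) (b : R) :
  (forall n m, f n + f m <= f (n + m)%N) -> (forall n, f n <= n%:R * b) ->
  exists l, [/\ f 1%N <= l <= b, (forall n, f n <= n%:R * l) &
    forall e, 0 < e -> exists C, forall n, n%:R * (l - e) - C <= f n].
Proof.
move=> fD fb.
pose E := [set f n.+1 / n.+1%:R | n in setT].
have Eub : has_ubound E.
  by exists b => _ [n _ <-]; rewrite ler_pdivrMr ?ltr0n// mulrC.
have E0 : E !=set0 by exists (f 1%N / 1); exists 0%N.
have Hub n : f n.+1 <= n.+1%:R * sup E.
  rewrite mulrC -ler_pdivrMr ?ltr0n//; apply: ub_le_sup => //.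
  by exists n.
exists (sup E); split.
- apply/andP; split; first by have := Hub 0%N; rewrite mul1r.
  by apply: ge_sup => // _ [n _ <-]; rewrite ler_pdivrMr ?ltr0n// mulrC.
- by case=> [|n]; [rewrite mul0r; have := fb 0%N; rewrite mul0r|exact: Hub].
- move=> e e0.
  have [_ [m0 _ <-] Hm] := sup_adherent e0 (conj E0 Eub).
  set m := m0.+1 in Hm.
  set l := sup E - e in Hm *.
  have hm : m%:R * l <= f m by rewrite mulrC -ler_pdivlMr ?ltr0n// ltW.
  have hq q : q%:R * (m%:R * l) + f 0%N <= f (q * m)%N.
    elim: q => [|q IH]; first by rewrite mul0r add0r mul0n.
    rewrite mulSn; apply: le_trans (fD _ _).
    rewrite mulrS mulrDl mul1r -addrA; exact: lerD.
  exists (\sum_(r < m) (`|f r| + `|r%:R * l|) + `|f 0%N|) => n.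
  rewrite {1 2}(divn_eq n m); apply: le_trans (fD _ _).
  have := hq (n %/ m)%N.
  have rm : (n %% m < m)%N by rewrite ltn_pmod.
  rewrite (bigD1 (Ordinal rm))//=.
  set S := \sum_(_ < _ | _) _.
  have S0 : 0 <= S by apply: sumr_ge0 => i _; rewrite addr_ge0.
  have := ler_norm ((n %% m)%:R * l).
  have := ler_norm (- f (n %% m)%N); rewrite normrN.
  have := ler_norm (- f 0%N); rewrite normrN.
  rewrite natrD natrM mulrDl mulrA.
  lra.
Qed.

End Fekete.

(** * Joining and closing walks *)

Section Joining.
Variables (R : realType) (G : mpsystem R).
Implicit Types (u v w : vertex G) (s : seq (edge G)).

Lemma lognorm_ge u v s a : alive u v s -> pnorm u v s <= expR a ->
  - a <= lognorm u v s.
Proof.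
by move=> /andP[_ h0] h; rewrite lerN2 -ler_expR lnK.
Qed.

Lemma entry_lognorm u v s i j : walk u v s -> 0 < pathmx u v s i j ->
  alive u v s /\ lognorm u v s <= - ln (pathmx u v s i j).
Proof.
move=> wlk h0.
have le : pathmx u v s i j <= pnorm u v s.
  by apply: le_entry_mxnorm1; exact: pathmx_ge0.
have p0 := lt_le_trans h0 le.
by rewrite /alive wlk p0 lerN2 ler_ln.
Qed.

Hypothesis irr : irreducible_system G.

(** Link the heaviest entries of the two products by a connector: the norm of
    the product of the three is then at least a constant times the product of
    the norms, while submultiplicativity gives the opposite inequality. *)
Lemma join_paths : exists2 K : R, 1 <= K &
  forall u1 v1 s1 u2 v2 s2, alive u1 v1 s1 -> alive u2 v2 s2 -> exists s,
    [/\ alive u1 v2 s,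
        `|lognorm u1 v2 s - (lognorm u1 v1 s1 + lognorm u2 v2 s2)| <= K &
        `|logweight s - (logweight s1 + logweight s2)| <= K].
Proof.
have [K1 K11 H1] := connector irr.
have [K2 K21 H2] := heavy_entry G.
exists (K1 + K2 + K2); first lra.
move=> u1 v1 s1 u2 v2 s2 a1 a2.
have [i1 [j1 h1]] := H2 _ _ _ a1.
have [i2 [j2 h2]] := H2 _ _ _ a2.
have [t [_ wt wK nK tK]] := H1 _ _ j1 i2.
have [/andP[w1 p1] /andP[w2 p2]] := (a1, a2).
have e1 : 0 < pathmx u1 v1 s1 i1 j1.
  by have := lt_le_trans p1 h1; rewrite pmulr_rgt0 ?expR_gt0.
have e2 : 0 < pathmx u2 v2 s2 i2 j2.
  by have := lt_le_trans p2 h2; rewrite pmulr_rgt0 ?expR_gt0.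
have et : 0 < pathmx v1 u2 t j1 i2 := lt_le_trans (expR_gt0 _) tK.
have wt2 := walk_cat wt w2.
have w12 := walk_cat w1 wt2.
(* The walk through the chosen entries contributes one term of T(s1 t s2). *)
have ent : pathmx u1 v1 s1 i1 j1 *
      (pathmx v1 u2 t j1 i2 * pathmx u2 v2 s2 i2 j2)
    <= pathmx u1 v2 (s1 ++ t ++ s2) i1 j2.
  rewrite (pathmx_cat w1 wt2).
  apply: le_trans (le_entry_mulmx i1 j1 j2 _ _); last 2 first.
  - exact: pathmx_ge0.
  - exact: pathmx_ge0.
  apply: ler_wpM2l; first exact: ltW.
  by rewrite (pathmx_cat wt w2); apply: le_entry_mulmx; exact: pathmx_ge0.
have ent0 : 0 < pathmx u1 v2 (s1 ++ t ++ s2) i1 j2.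
  by apply: lt_le_trans ent; rewrite !mulr_gt0.
have [a12 l12] := entry_lognorm w12 ent0.
have [_ at2 b1] := alive_cat w1 wt2 a12.
have [a_t _ b2] := alive_cat wt w2 at2.
have b3 := lognorm_ge a_t nK.
exists (s1 ++ t ++ s2); split=> //; last first.
  rewrite !logweight_cat.
  have w0 := logweight_ge0 t.
  rewrite ler_norml; apply/andP; split; lra.
have up : lognorm u1 v2 (s1 ++ t ++ s2) <=
    lognorm u1 v1 s1 + lognorm u2 v2 s2 + K1 + K2 + K2.
  apply: le_trans l12 _.
  rewrite lerNl -ler_expR [leRHS]lnK ?posrE//.
  apply: le_trans ent.
  rewrite [leLHS](_ : _ = (expR (- K2) * expR (- lognorm u1 v1 s1)) *
    (expR (- K1) * (expR (- K2) * expR (- lognorm u2 v2 s2)))); last first.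
    by rewrite -!expRD; congr expR; lra.
  rewrite !opprK !lnK ?posrE//.
  have f1 : expR (- K2) * pnorm u1 v1 s1 <= pathmx u1 v1 s1 i1 j1.
    by rewrite expRN mulrC ler_pdivrMr ?expR_gt0// mulrC.
  have f2 : expR (- K2) * pnorm u2 v2 s2 <= pathmx u2 v2 s2 i2 j2.
    by rewrite expRN mulrC ler_pdivrMr ?expR_gt0// mulrC.
  by rewrite !ler_pM ?mulr_ge0 ?expR_ge0// ltW.
rewrite ler_norml; apply/andP; split; lra.
Qed.

(** Linking the heaviest entry of [T(s)] to itself gives a cycle with a large
    diagonal entry.  Such an entry bounds the spectral radius of the cycle from
    below, as the norm bounds it from above. *)
Lemma close_path : exists2 K : R, 1 <= K &
  forall u v s, alive u v s -> exists c i,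
    [/\ c != [::], walk u u c, 0 < pathmx u u c i i &
     [/\ - ln (pathmx u u c i i) <= lognorm u v s + K,
        lognorm u v s - K <= lognorm u u c &
        `|logweight c - logweight s| <= K]].
Proof.
have [K1 K11 H1] := connector irr.
have [K2 K21 H2] := heavy_entry G.
exists (K1 + K2); first lra.
move=> u v s a.
have [i [j h]] := H2 _ _ _ a.
have [t [t_ne wt wK nK tK]] := H1 _ _ j i.
have /andP[w p] := a.
have e : 0 < pathmx u v s i j.
  by have := lt_le_trans p h; rewrite pmulr_rgt0 ?expR_gt0.
have et : 0 < pathmx v u t j i := lt_le_trans (expR_gt0 _) tK.
have wst := walk_cat w wt.
have ent : pathmx u v s i j * pathmx v u t j i <= pathmx u u (s ++ t) i i.
  by rewrite (pathmx_cat w wt); apply: le_entry_mulmx; exact: pathmx_ge0.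
have ent0 : 0 < pathmx u u (s ++ t) i i.
  by apply: lt_le_trans ent; rewrite mulr_gt0.
have [ast lst] := entry_lognorm wst ent0.
have [_ a_t b1] := alive_cat w wt ast.
have b2 := lognorm_ge a_t nK.
exists (s ++ t), i; split=> //.
  by case: (s) t_ne.
split.
- rewrite lerNl -ler_expR [leRHS]lnK ?posrE//.
  apply: le_trans ent.
  rewrite [leLHS](_ : _ =
    (expR (- K2) * expR (- lognorm u v s)) * expR (- K1)); last first.
    by rewrite -!expRD; congr expR; lra.
  rewrite !opprK !lnK ?posrE//.
  have f1 : expR (- K2) * pnorm u v s <= pathmx u v s i j.
    by rewrite expRN mulrC ler_pdivrMr ?expR_gt0// mulrC.
  by rewrite !ler_pM ?mulr_ge0 ?expR_ge0// ltW.
- lra.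
- rewrite !logweight_cat.
  have w0 := logweight_ge0 t.
  rewrite ler_norml; apply/andP; split; lra.
Qed.

End Joining.


(** * Infinite paths *)

Lemma mkseqD (T : Type) (f : nat -> T) n m :
  mkseq f (n + m) = mkseq f n ++ mkseq (fun k => f (n + k)%N) m.
Proof.
rewrite /mkseq iotaD map_cat add0n; congr (_ ++ _).
by rewrite -[in LHS](addn0 n) iotaDl -map_comp.
Qed.

Section InfinitePaths.
Variables (R : realType) (G : mpsystem R).
Implicit Types (u v w : vertex G) (s : seq (edge G)) (g : nat -> edge G).

Lemma walk_segment g n m : infinite_path g ->
  walk (src (g n)) (src (g (n + m)%N)) (mkseq (fun k => g (n + k)%N) m).
Proof.
move=> gP; elim: m => [|m IH]; first by rewrite addn0 /= eqxx.
rewrite mkseqS -cats1; apply: walk_cat IH _.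
by rewrite /= eqxx /= gP addnS.
Qed.

Lemma walk_prefix g n : infinite_path g ->
  walk (src (g 0%N)) (src (g n)) (mkseq g n).
Proof. by move=> gP; have := walk_segment 0 n gP. Qed.

Definition prefix_lognorm g n : R :=
  lognorm (src (g 0%N)) (src (g n)) (mkseq g n).
Definition prefix_logweight g n : R := logweight (mkseq g n).

Lemma alive_prefix g n : infinite_path g -> 0 < prefix_norm g n ->
  alive (src (g 0%N)) (src (g n)) (mkseq g n).
Proof. by move=> gP h; rewrite /alive walk_prefix. Qed.

Lemma prefix_logweightS g n : prefix_logweight g n.+1 =
  prefix_logweight g n + logweight [:: g n].
Proof. by rewrite /prefix_logweight mkseqS -cats1 logweight_cat. Qed.

Lemma ln_pathweight_mkseq g n :
  ln (pathweight (mkseq g n)) = - prefix_logweight g n.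
Proof. by rewrite opprK. Qed.

Lemma prefix_logweight_size : exists2 K : R, 1 <= K &
  forall g n, n%:R <= K * prefix_logweight g n /\
              prefix_logweight g n <= K * n%:R.
Proof.
have [K K1 H] := logweight_size G; exists K => // g n.
by have := H (mkseq g n); rewrite size_mkseq.
Qed.

(** An error that is sublinear in the weight disappears in the quotient.  The
    positivity hypothesis keeps [lne] away from minus infinity. *)
Lemma lyapunov_of_tame g l : infinite_path g ->
  (forall n, 0 < prefix_norm g n) ->
  (forall e, 0 < e -> exists C, forall n,
     `|prefix_lognorm g n - l * prefix_logweight g n|
       <= e * prefix_logweight g n + C) ->
  lyapunov g l%:E.
Proof.
move=> gP pos tame; rewrite /lyapunov.
rewrite (_ : (fun n => _) = EFin \o
    (fun n => prefix_lognorm g n / prefix_logweight g n)); last first.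
  apply/funext => n. rewrite lne_EFin// ln_pathweight_mkseq -EFinM /=.
  by congr (_%:E); rewrite invrN mulrN -mulNr.
apply: cvg_EFin; first by near=> n.
apply/cvgrPdist_le => /= e e0.
have [K K1 HK] := prefix_logweight_size.
have e20 : 0 < e / 2 by lra.
have [C HC] := tame _ e20.
near=> n.
have [h1 _] := HK g n.
have n1 : 1 + K * (2 * `|C| / e) <= n%:R.
  by near: n; exact: nbhs_infty_ger.
have K0 : 0 < K by lra.
set w := prefix_logweight g n in h1 *.
have w1 : 2 * `|C| / e < w.
  rewrite -(ltr_pM2l K0); lra.
have w0 : 0 < w.
  apply: le_lt_trans w1; rewrite divr_ge0 ?mulr_ge0// ltW//.
rewrite (_ : l - _ = - (prefix_lognorm g n - l * w) / w); last first.
  by rewrite /w; field; rewrite gt_eqF.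
rewrite normrM normrN normfV (gtr0_norm w0) ler_pdivrMr//.
apply: le_trans (HC n) _.
rewrite ltr_pdivrMr// in w1.
have := ler_norm C.
rewrite -/w; lra.
Unshelve. all: by end_near.
Qed.

(** A finite exponent forces the prefix norms to be nonzero from some point on,
    since a zero norm makes the quotient equal to plus infinity. *)
Lemma lyapunov_approx g l e : infinite_path g -> lyapunov g l%:E -> 0 < e ->
  exists N, forall n, (N <= n)%N -> 0 < prefix_norm g n /\
    `|prefix_lognorm g n - l * prefix_logweight g n|
      <= e * prefix_logweight g n.
Proof.
move=> gP; rewrite /lyapunov => /fine_cvgP[fin /cvgrPdist_le cvg] e0.
have [K K1 HK] := prefix_logweight_size.
have [N _ HN] : \forall n \near \oo, 0 < prefix_norm g n /\
    `|prefix_lognorm g n - l * prefix_logweight g n|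
      <= e * prefix_logweight g n.
  near=> n.
  have [h1 _] := HK g n.
  have n1 : 1 <= n%:R :> R by near: n; exact: nbhs_infty_ger.
  have w0 : 0 < prefix_logweight g n by nra.
  have : (lne (prefix_norm g n)%:E * ((ln (pathweight (mkseq g n)))^-1)%:E)%E
      \is a fin_num by near: n.
  have : `|l - fine (lne (prefix_norm g n)%:E *
      ((ln (pathweight (mkseq g n)))^-1)%:E)%E| <= e.
    by near: n; exact: cvg.
  rewrite ln_pathweight_mkseq.
  have [p0|p0] := ltP 0 (prefix_norm g n); last first.
    rewrite le0_lneNy ?lee_fin// => _.
    by rewrite invrN mulNyr ltr0_sg ?oppr_lt0 ?invr_gt0// mulN1e.
  rewrite lne_EFin//= => h _; split => //.
  rewrite (_ : _ - _ = - (l - (ln (prefix_norm g n) / - prefix_logweight g n)) *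
     prefix_logweight g n); last first.
    rewrite /prefix_lognorm /lognorm -/(prefix_norm g n); field.
    by rewrite gt_eqF.
  rewrite normrM normrN (gtr0_norm w0).
  by apply: ler_wpM2r => //; exact: ltW.
by exists N => n Nn; apply: HN.
Unshelve. all: by end_near.
Qed.

(** Cut [g] at the first prefix whose weight is below [expR (- x)]: this prefix
    lies in [Sigma_t] for [t = expR (- x)].  As one edge changes [logweight] by
    a bounded amount only, the logarithmic weight of the prefix is [x] up to a
    constant, and the definition of the exponent applies. *)
Lemma trace_path g l e : infinite_path g -> lyapunov g l%:E -> 0 < e ->
  exists X, forall x, X <= x -> exists u v s,
    [/\ s != [::], alive u v s,
        logweight (take (size s).-1 s) <= x < logweight s &
        `|lognorm u v s - l * x| <= e * x].
Proof.
move=> gP gl e0.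
have [K K1 HK] := prefix_logweight_size.
have K0 : 0 < K by lra.
have e20 : 0 < e / 2 by lra.
have [N HN] := lyapunov_approx gP gl e20.
exists (K * N%:R + (e / 2 + `|l|) * K / (e / 2)) => x hx.
have q0 : 0 <= (e / 2 + `|l|) * K / (e / 2).
  by rewrite !mulr_ge0 ?addr_ge0 ?invr_ge0//; lra.
have N0 : 0 <= K * N%:R by rewrite mulr_ge0// ltW.
have [n0 hn0] : exists n, x < prefix_logweight g n.
  have [n hn] : exists n : nat, K * x < n%:R.
    by exists (Num.bound (K * x)); apply: archi_boundP; apply: mulr_ge0; lra.
  exists n; have [h _] := HK g n.
  by rewrite -(ltr_pM2l K0); apply: lt_le_trans h.
case: (ex_minnP (ex_intro (fun n => x < prefix_logweight g n) n0 hn0)).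
move=> n hn nmin.
have n_gt0 : (0 < n)%N.
  rewrite lt0n; apply/eqP => n0'; move: hn.
  by rewrite n0' /prefix_logweight logweight_nil; lra.
have Nn : (N <= n)%N.
  rewrite leqNgt; apply/negP => nN.
  have [_ h] := HK g n.
  have : (n%:R : R) <= N%:R by rewrite ler_nat ltnW.
  nra.
have hn1 : prefix_logweight g n.-1 <= x.
  rewrite leNgt; apply/negP => h; have := nmin _ h.
  by rewrite -ltnS prednK// ltnn.
have hstep : prefix_logweight g n <= x + K.
  have := prefix_logweightS g n.-1; rewrite prednK// => ->.
  have [_] := HK (fun=> g n.-1) 1%N; rewrite mulr1 /prefix_logweight /=.
  lra.
have [p0 hl] := HN _ Nn.
exists (src (g 0%N)), (src (g n)), (mkseq g n); split.
- by rewrite -size_eq0 size_mkseq -lt0n.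
- exact: alive_prefix.
- rewrite size_mkseq; apply/andP; split=> //.
  suff -> : take n.-1 (mkseq g n) = mkseq g n.-1 by [].
  rewrite -{2}(prednK n_gt0) mkseqS -cats1 takel_cat ?size_mkseq//.
  by rewrite take_oversize ?size_mkseq.
- set L := lognorm _ _ _.
  set w := prefix_logweight g n in hn hl hstep.
  have -> : L - l * x = (L - l * w) + l * (w - x) by ring.
  apply: le_trans (ler_normD _ _) _.
  rewrite normrM (gtr0_norm (x := w - x)); last by lra.
  have t1 : `|l| * (w - x) <= `|l| * K by apply: ler_wpM2l => //; lra.
  have t2 : e / 2 * w <= e / 2 * (x + K) by apply: ler_wpM2l => //; lra.
  have t3 : (e / 2 + `|l|) * K <= e / 2 * x.
    rewrite [leRHS]mulrC -ler_pdivrMr//; lra.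
  have hl' : `|L - l * w| <= e / 2 * w := hl.
  lra.
Qed.

End InfinitePaths.


(** * Periodic paths *)

Lemma walk_nth (G : digraph) (u v : vertex G) s e0 i : walk u v s ->
  (i < size s)%N ->
  tgt (nth e0 s i) = if (i.+1 < size s)%N then src (nth e0 s i.+1) else v.
Proof.
elim: s u i => [//|e s IH] u i /= /andP[_ wlk].
case: i => [_|i]; last by rewrite !ltnS; exact: IH wlk.
rewrite ltnS /=; case: s wlk {IH} => [|e' s] /=; first by move/eqP.
by case/andP => /eqP.
Qed.

Section PeriodicPaths.
Variables (R : realType) (G : mpsystem R).
Implicit Types (u v w : vertex G) (s : seq (edge G)) (g : nat -> edge G).

Lemma cycle_infinite_path u s e0 : s != [::] -> walk u u s ->
  infinite_path (fun n => nth e0 s (n %% size s)).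
Proof.
move=> s_ne wlk n.
have s0 : (0 < size s)%N by rewrite lt0n size_eq0.
rewrite (walk_nth e0 wlk) ?ltn_pmod// modnS.
have [lt|ge] := ltnP.
  case: ifP => // dv; exfalso.
  have := dv; rewrite /dvdn -addn1 -modnDml addn1 modn_small//.
have -> : (size s %| n.+1)%N.
  have : (n %% size s).+1 = size s.
    by apply/eqP; rewrite eqn_leq ge andbT ltn_pmod.
  by move=> h; rewrite /dvdn -addn1 -modnDml addn1 h modnn.
by case: s s0 wlk {s_ne ge} => // e s _ /andP[/eqP ->].
Qed.

(** The path is the repetition of the cycle [s].  Along whole periods the
    sequence [lognorm] is superadditive and the powers of the positive diagonal
    entry bound it above linearly, so it has a growth rate by Fekete's lemma;
    any other prefix differs from whole periods by at most one period, which
    costs a constant.  The two final inequalities locate the exponent by means of the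
    norm and of the diagonal entry of the cycle, without its spectral radius. *)
Lemma periodic_exponent_exists u s i : s != [::] -> walk u u s ->
  0 < pathmx u u s i i ->
  exists g l, [/\ Defs.periodic g, lyapunov g l%:E,
    lognorm u u s <= l * logweight s &
    l * logweight s <= - ln (pathmx u u s i i)].
Proof.
move=> s_ne wlk a0.
have [e0 he0] : exists e0, nth e0 s 0 = e0.
  by case: (s) s_ne => // e s' _; exists e.
pose g n := nth e0 s (n %% size s).
have M0 : (0 < size s)%N by rewrite lt0n size_eq0.
set M := size s in M0.
have gP : infinite_path g by exact: cycle_infinite_path wlk.
have g0 : g 0%N = e0 by rewrite /g mod0n.
have gu : src (g 0%N) = u.
  by rewrite /g mod0n; case: (s) s_ne wlk => // e s' _ /andP[/eqP].
have gper k m : g (k * M + m)%N = g m by rewrite /g modnMDl.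
have guk k : src (g (k * M)%N) = u by rewrite -[X in g X]addn0 gper gu.
have gD k m : mkseq g (k * M + m) = mkseq g (k * M) ++ mkseq g m.
  by rewrite mkseqD; congr (_ ++ _); apply: eq_mkseq => j; exact: gper.
have gM : mkseq g M = s.
  rewrite -[RHS](mkseq_nth e0); apply/eq_in_map => j.
  rewrite mem_iota => /andP[_ jM].
  by rewrite /g modn_small.
pose c k := mkseq g (k * M).
have wc k : walk u u (c k).
  by have := walk_prefix (k * M) gP; rewrite gu guk.
have cD k m : c (k + m)%N = c k ++ c m by rewrite /c mulnDl gD.
have c1 : c 1%N = s by rewrite /c mul1n gM.
set a := pathmx u u s i i in a0 *.
have ack k : a ^+ k <= pathmx u u (c k) i i.
  elim: k => [|k IH]; first by rewrite (_ : c 0%N = [::])// pathmx_nil mxE eqxx.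
  rewrite exprSr -[k.+1]addn1 cD (pathmx_cat (wc k) (wc 1%N)).
  apply: le_trans (le_entry_mulmx i i i _ _); [|exact: pathmx_ge0..].
  by rewrite c1; apply: ler_wpM2r => //; exact: ltW.
have cpos k : 0 < pathmx u u (c k) i i := lt_le_trans (exprn_gt0 k a0) (ack k).
have calive k : alive u u (c k) := (entry_lognorm (wc k) (cpos k)).1.
pose f k := lognorm u u (c k).
have fD n m : f n + f m <= f (n + m)%N.
  by have := calive (n + m)%N; rewrite /f cD => /(alive_cat (wc n) (wc m))[].
have fb n : f n <= n%:R * (- ln a).
  apply: le_trans (entry_lognorm (wc n) (cpos n)).2 _.
  rewrite mulrN lerN2 mulr_natl -lnXn// ler_ln ?posrE ?exprn_gt0//.
have [l [/andP[l1 l2] fl fe]] := fekete fD fb.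
have [KW KW1 HW] := logweight_size G.
have [KN KN1 HN] := lognorm_bound G.
set W := logweight s.
have W0 : 0 < W.
  have [h _] := HW s.
  have : 1 <= (size s)%:R :> R by rewrite ler1n.
  by rewrite /W; nra.
(* A prefix that ends inside period k is compared from below with k periods and
   from above with k + 1 periods. *)
have alive_pre n : alive u (src (g n)) (mkseq g n) /\
    exists k, [/\ f k - KN * (W + 1) <= lognorm u (src (g n)) (mkseq g n),
    lognorm u (src (g n)) (mkseq g n) <= f k.+1 + KN * (W + 1) &
    k%:R * W <= prefix_logweight g n <= k.+1%:R * W].
  have wck k : logweight (c k) = k%:R * W.
    elim: k => [|k IH]; first by rewrite /c /= logweight_nil mul0r.
    by rewrite -addn1 cD logweight_cat IH c1 natrD mulrDl mul1r.
  pose k := (n %/ M)%N; pose r := (n %% M)%N.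
  have nE : n = (k * M + r)%N := divn_eq n M.
  have rM : (r < M)%N by rewrite ltn_pmod.
  have nE' : (k.+1 * M = n + (M - r))%N.
    by rewrite {1}nE mulSn -addnA subnKC 1?addnC// ltnW.
  have w1 : walk u (src (g n)) (mkseq g n) by rewrite -gu; exact: walk_prefix.
  have w2 : walk (src (g n)) u (mkseq (fun j => g (n + j)%N) (M - r)).
    by rewrite -(guk k.+1) nE'; exact: walk_segment.
  have cE : c k.+1 = mkseq g n ++ mkseq (fun j => g (n + j)%N) (M - r).
    by rewrite /c nE' mkseqD.
  have := calive k.+1; rewrite cE => /(alive_cat w1 w2)[a1 a2 le2].
  split => //; exists k.
  have w3 : walk u (src (g n)) (mkseq g r).
    by rewrite -gu nE gper; exact: walk_prefix.
  have cE' : mkseq g n = c k ++ mkseq g r by rewrite {1}nE gD.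
  have [_ a3 le3] := alive_cat (wc k) w3 (etrans (congr1 _ (esym cE')) a1).
  rewrite -cE' in le3.
  have b1 := HN _ _ _ a2.
  have b2 := HN _ _ _ a3.
  have e1 : k.+1%:R * W = prefix_logweight g n +
      logweight (mkseq (fun j => g (n + j)%N) (M - r)).
    by rewrite -wck cE logweight_cat.
  have e2 : prefix_logweight g n = k%:R * W + logweight (mkseq g r).
    by rewrite /prefix_logweight cE' logweight_cat wck.
  have p1 := logweight_ge0 (mkseq (fun j => g (n + j)%N) (M - r)).
  have p2 := logweight_ge0 (mkseq g r).
  have e1' := e1; rewrite -natr1 mulrDl mul1r in e1'.
  have q1 : KN * (logweight (mkseq g r) + 1) <= KN * (W + 1).
    by apply: ler_wpM2l; lra.
  have q2 : KN * (logweight (mkseq (fun j => g (n + j)%N) (M - r)) + 1) <=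
      KN * (W + 1).
    by apply: ler_wpM2l; lra.
  rewrite -cE -/(f k.+1) in le2.
  rewrite -/(f k) in le3.
  rewrite ler_norml in b1; rewrite ler_norml in b2.
  have /andP[b11 b12] := b1; have /andP[b21 b22] := b2.
  split; [lra|lra|].
  by apply/andP; split; lra.
have lW : l / W * W = l by rewrite divfK// gt_eqF.
exists g, (l / W); split; last 2 first.
- by rewrite lW; move: l1; rewrite /f c1.
- by rewrite lW.
- split => //; exists u, s; split => // n.
  by rewrite /g mod0n he0.
apply: lyapunov_of_tame => //.
  by move=> n; have [/andP[_ h] _] := alive_pre n; move: h; rewrite -gu.
move=> e ep.
have eW : 0 < e * W by rewrite mulr_gt0.
have [C HC] := fe _ eW.
exists (C + `|C| + `|l| + `|l| + KN * (W + 1)) => n.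
have [_ [k [h1 h2 /andP[h3 h4]]]] := alive_pre n.
rewrite /prefix_lognorm gu; set L := lognorm _ _ _ in h1 h2 *.
set w := prefix_logweight g n in h3 h4 *.
have hk := HC k; have hk1 := fl k.+1.
have d : `|k%:R * l - l / W * w| <= `|l|.
  have -> : k%:R * l - l / W * w = l * ((k%:R * W - w) / W).
    by field; rewrite gt_eqF.
  rewrite normrM -[leRHS]mulr1; apply: ler_wpM2l => //.
  rewrite normrM normfV (gtr0_norm W0) ler_pdivrMr// mul1r ler_norml.
  by move: h4; rewrite -natr1 mulrDl mul1r => h4; apply/andP; split; lra.
rewrite ler_norml in d; have /andP[d1 d2] := d.
have h5 : e * (k%:R * W) <= e * w by apply: ler_wpM2l => //; exact: ltW.
have h6 : 0 <= e * (k%:R * W) by rewrite !mulr_ge0// ltW.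
rewrite -natr1 mulrDl mul1r in hk1.
have := ler_norm l; have := ler_norm (- l); rewrite normrN.
have := ler_norm C; have := ler_norm (- C); rewrite normrN.
rewrite mulrBr in hk.
have q : 0 <= KN * (W + 1) by apply: mulr_ge0; lra.
move=> *; rewrite ler_norml; apply/andP; split; lra.
Qed.

(** The exponent plus infinity, of periodic paths on which the product vanishes,
    is left out: it does not belong to the interval to be filled. *)
Definition real_exponents : set R :=
  [set l | periodic_exponents G l%:E].

Lemma trace_exponent l e : real_exponents l -> 0 < e ->
  exists X, forall x, X <= x -> exists u v s,
    [/\ s != [::], alive u v s,
        logweight (take (size s).-1 s) <= x < logweight s &
        `|lognorm u v s - l * x| <= e * x].
Proof.
by move=> [g [[gP _] gl]]; exact: trace_path.
Qed.

Lemma overshoot : exists2 K : R, 1 <= K & forall s x, s != [::] ->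
  logweight (take (size s).-1 s) <= x < logweight s -> logweight s <= x + K.
Proof.
have [K K1 HK] := logweight_size G; exists K => // s x.
case/lastP: s => [//|s e] _.
rewrite size_rcons /= -cats1 take_size_cat// logweight_cat => /andP[h _].
have [_] := HK [:: e]; rewrite mulr1; lra.
Qed.

(** Read off a long prefix: its [lognorm] is at most linear in its weight. *)
Lemma real_exponents_bounded : exists2 B : R, 1 <= B &
  forall l, real_exponents l -> `|l| <= B.
Proof.
have [K K1 HK] := overshoot.
have [N N1 HN] := lognorm_bound G.
exists (N * (K + 2) + 1) => [|l lP]; first nra.
have [X HX] := trace_exponent lP ltr01.
have hX : X <= Num.max X 1 by rewrite le_max lexx.
set x := Num.max X 1 in hX.
have x1 : 1 <= x by rewrite le_max lexx orbT.
have [u [v [s [s_ne sa hx hl]]]] := HX _ hX.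
have h1 := HK _ _ s_ne hx.
have h2 := HN _ _ _ sa.
have h3 : N * (logweight s + 1) <= N * ((K + 2) * x).
  by apply: ler_wpM2l; nra.
rewrite -(@ler_pM2r _ x); last by lra.
rewrite -[X in _ * X <= _](gtr0_norm (x := x)); last by lra.
rewrite -normrM.
have -> : l * x = lognorm u v s - (lognorm u v s - l * x) by ring.
apply: le_trans (ler_normB _ _) _.
lra.
Qed.

Hypothesis irr : irreducible_system G.

(** The central comparison: every walk with nonzero product shadows a periodic
    path, with an error independent of the walk.  The weight of the closing
    walk is absorbed thanks to the boundedness of the exponents. *)
Lemma close_exponent : exists2 K : R, 1 <= K & forall u v s, alive u v s ->
  exists2 l, real_exponents l & `|lognorm u v s - l * logweight s| <= K.
Proof.
have [K K1 HK] := close_path irr.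
have [B B1 HB] := real_exponents_bounded.
exists (K + B * K); first by nra.
move=> u v s sa.
have [c [i [c_ne wc c0 [h1 h2 h3]]]] := HK _ _ _ sa.
have [g [l [gP gl l1 l2]]] := periodic_exponent_exists c_ne wc c0.
have lP : real_exponents l by exists g.
exists l => //.
have -> : lognorm u v s - l * logweight s =
  (lognorm u v s - l * logweight c) + l * (logweight c - logweight s) by ring.
apply: le_trans (ler_normD _ _) _; apply: lerD.
  by rewrite ler_norml; apply/andP; split; lra.
by rewrite normrM; apply: ler_pM => //; exact: HB.
Qed.

Lemma real_exponents_neq0 : real_exponents !=set0.
Proof.
have /card_gt0P[v _] := vertex_gt0 G.
have [K _ HK] := close_exponent.
by have [l lP _] := HK _ _ _ (alive_nil v); exists l.
Qed.

(** * The limits of the log ratios *)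

(** The comparison [close_exponent], divided by [x], for a walk of [Sigma_t]. *)
Lemma log_ratios_near_exponent e : 0 < e -> exists X, forall x r, X <= x ->
  log_ratios G (expR (- x)) r ->
  exists2 l, real_exponents l & `|r - l| <= e.
Proof.
move=> e0.
have [K K1 HK] := close_exponent.
have [B B1 HB] := real_exponents_bounded.
have [D D1 HD] := overshoot.
exists (1 + (K + B * D) / e) => x r hx.
move=> [u [v [s [[s_ne wlk /andP[w1 w2] n0] rE]]]].
have q : 0 <= (K + B * D) / e by apply: divr_ge0; nra.
have x0 : 0 < x by lra.
have sa : alive u v s by rewrite /alive wlk.
have [l lP hl] := HK _ _ _ sa; exists l => //.
have hx1 : logweight (take (size s).-1 s) <= x < logweight s.
  apply/andP; split.
    by rewrite lerNl -ler_expR lnK ?posrE ?pathweight_gt0.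
  by rewrite ltrNr -ltr_expR lnK ?posrE ?pathweight_gt0.
have hx2 := HD _ _ s_ne hx1.
have /andP[_ hx3] := hx1.
have -> : r - l =
    ((lognorm u v s - l * logweight s) + l * (logweight s - x)) / x.
  by rewrite rE expRK /lognorm /pnorm; field; rewrite gt_eqF.
rewrite normrM normfV (gtr0_norm x0) ler_pdivrMr//.
apply: le_trans (ler_normD _ _) _.
have h1 : `|l * (logweight s - x)| <= B * D.
  rewrite normrM; apply: ler_pM => //; first exact: HB.
  by rewrite gtr0_norm; lra.
apply: (@le_trans _ _ (K + B * D)); first exact: lerD.
rewrite [leRHS]mulrC -ler_pdivrMr//; lra.
Qed.

Lemma exponent_near_log_ratios l e : real_exponents l -> 0 < e ->
  exists X, forall x, X <= x ->
  exists2 r, log_ratios G (expR (- x)) r & `|r - l| <= e.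
Proof.
move=> lP e0.
have [X HX] := trace_exponent lP e0.
exists (Num.max X 1) => x; rewrite ge_max => /andP[hx x1].
have [u [v [s [s_ne /andP[wlk p0] /andP[h1 h2] h3]]]] := HX _ hx.
exists (lognorm u v s / x).
  exists u, v, s; split; last by rewrite expRK invrN mulrN -mulNr.
  split => //; apply/andP; split.
    by rewrite -[X in X < _]lnK ?posrE ?pathweight_gt0// ltr_expR ltrNr.
  by rewrite -[X in _ <= X]lnK ?posrE ?pathweight_gt0// ler_expR lerNl.
have x0 : 0 < x by lra.
have -> : lognorm u v s / x - l = (lognorm u v s - l * x) / x.
  by field; rewrite gt_eqF.
by rewrite normrM normfV (gtr0_norm x0) ler_pdivrMr.
Qed.

(** Mix the two periodic paths: join a walk of logarithmic weight about [t * X]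
    along the first with one of weight about [(1 - t) * X] along the second, and
    close up.  Joining and closing cost a constant, negligible with respect
    to [X]. *)
Lemma exponents_intermediate l1 l2 a e :
  real_exponents l1 -> real_exponents l2 ->
  l1 < a < l2 -> 0 < e -> exists2 l, real_exponents l & `|l - a| <= e.
Proof.
move=> P1 P2 /andP[la al] e0.
have [t /andP[t0 t1] at_] : exists2 t, 0 < t < 1 & a = t * l1 + (1 - t) * l2.
  exists ((l2 - a) / (l2 - l1)); last by field; lra.
  have l12 : 0 < l2 - l1 by lra.
  by apply/andP; split; [apply: divr_gt0; lra|rewrite ltr_pdivrMr//; lra].
have [K K1 HK] := close_exponent.
have [J J1 HJ] := join_paths irr.
have [B B1 HB] := real_exponents_bounded.
have [D D1 HD] := overshoot.
have e20 : 0 < e / 2 by lra.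
have [X1 H1] := trace_exponent P1 e20.
have [X2 H2] := trace_exponent P2 e20.
(* T collects the errors that do not grow with X. *)
pose T := K + J + B * (J + D + D).
have T0 : 0 <= T by rewrite /T; nra.
pose X := `|X1| / t + `|X2| / (1 - t) + 2 * T / e + 1.
have q1 : 0 <= `|X1| / t by apply: divr_ge0 => //; lra.
have q2 : 0 <= `|X2| / (1 - t) by apply: divr_ge0 => //; lra.
have q3 : 0 <= 2 * T / e by apply: divr_ge0 => //; lra.
have X0 : 0 < X by rewrite /X; lra.
have hX1 : X1 <= t * X.
  apply: le_trans (ler_norm _) _; rewrite mulrC -ler_pdivrMr// /X; lra.
have hX2 : X2 <= (1 - t) * X.
  apply: le_trans (ler_norm _) _.
  by rewrite mulrC -ler_pdivrMr ?subr_gt0// /X; lra.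
have hX3 : T <= e / 2 * X.
  have : 2 * T / e <= X by rewrite /X; lra.
  by rewrite ler_pdivrMr//; lra.
have [u1 [v1 [s1 [n1 a1 w1 b1]]]] := H1 _ hX1.
have [u2 [v2 [s2 [n2 a2 w2 b2]]]] := H2 _ hX2.
have z1 := HD _ _ n1 w1; have z2 := HD _ _ n2 w2.
have /andP[_ y1] := w1; have /andP[_ y2] := w2.
have [s [sa c1 c2]] := HJ _ _ _ _ _ _ a1 a2.
have [l lP d1] := HK _ _ _ sa; exists l => //.
have wX : `|logweight s - X| <= J + D + D.
  rewrite ler_norml in c2; have /andP[c21 c22] := c2.
  by rewrite ler_norml; apply/andP; split; lra.
have d2 : `|l * (logweight s - X)| <= B * (J + D + D).
  by rewrite normrM; apply: ler_pM => //; exact: HB.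
rewrite -(@ler_pM2r _ X)// -[X in _ * X <= _](gtr0_norm X0) -normrM.
have aX : a * X = l1 * (t * X) + l2 * ((1 - t) * X) by rewrite at_; ring.
rewrite mulrBl aX.
move: d2 d1 c1 b1 b2 hX3; rewrite /T !ler_norml.
move=> /andP[? ?] /andP[? ?] /andP[? ?] /andP[? ?] /andP[? ?] ?.
apply/andP; split; lra.
Qed.

Lemma cvg_along_expR (h : R -> R) l :
  (forall e, 0 < e -> exists X, forall x, X <= x ->
     `|l - h (expR (- x))| <= e) ->
  h t @[t --> 0^'+] --> l.
Proof.
move=> H; apply/cvgrPdist_le => /= e e0.
have [X HX] := H _ e0.
near=> t.
have t0 : 0 < t by near: t; exact: nbhs_right_gt.
have tX : t < expR (- X) by near: t; apply: nbhs_right_lt; exact: expR_gt0.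
rewrite -[t]lnK ?posrE// -[ln t]opprK; apply: HX.
by rewrite lerNr -ler_expR lnK ?posrE// ltW.
Unshelve. all: by end_near.
Qed.

Lemma has_sup_real_exponents : has_sup real_exponents.
Proof.
split; first exact: real_exponents_neq0.
have [B _ HB] := real_exponents_bounded.
by exists B => l /HB; rewrite ler_norml => /andP[].
Qed.

Lemma has_inf_real_exponents : has_inf real_exponents.
Proof.
split; first exact: real_exponents_neq0.
have [B _ HB] := real_exponents_bounded.
by exists (- B) => l /HB; rewrite ler_norml => /andP[].
Qed.

(** Every log ratio is near some exponent, and the nearly extreme exponents are
    near log ratios: the extreme values of the two sets are therefore close. *)
Lemma log_ratios_extrema_near e : 0 < e -> exists X, forall x, X <= x ->
  `|inf real_exponents - inf (log_ratios G (expR (- x)))| <= e /\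
  `|sup real_exponents - sup (log_ratios G (expR (- x)))| <= e.
Proof.
move=> e0.
have Psup := has_sup_real_exponents; have [_ Pub] := Psup.
have Pinf := has_inf_real_exponents; have [_ Plb] := Pinf.
have e20 : 0 < e / 2 by lra.
have [l1 lP1 hl1] := inf_adherent e20 Pinf.
have [l2 lP2 hl2] := sup_adherent e20 Psup.
have [X1 H1] := exponent_near_log_ratios lP1 e20.
have [X2 H2] := exponent_near_log_ratios lP2 e20.
have [X3 H3] := log_ratios_near_exponent e0.
exists (Num.max X1 (Num.max X2 X3)) => x.
rewrite !ge_max => /and3P[/H1[r1 rP1 hr1] /H2[r2 rP2 hr2] hx3].
have {}H3 r := H3 _ r hx3.
have Lub : ubound (log_ratios G (expR (- x))) (sup real_exponents + e).
  move=> r /H3[l lP]; rewrite ler_norml => /andP[h h'].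
  by have := ub_le_sup Pub lP; lra.
have Llb : lbound (log_ratios G (expR (- x))) (inf real_exponents - e).
  move=> r /H3[l lP]; rewrite ler_norml => /andP[h h'].
  by have := ge_inf Plb lP; lra.
rewrite !ler_norml in hr1 hr2.
have /andP[a1 a2] := hr1; have /andP[b1 b2] := hr2.
have h1 : inf real_exponents - e <= inf (log_ratios G (expR (- x))).
  by apply: lb_le_inf => //; exists r1.
have h2 : inf (log_ratios G (expR (- x))) <= r1.
  by apply: ge_inf => //; eexists; exact: Llb.
have h3 : sup (log_ratios G (expR (- x))) <= sup real_exponents + e.
  by apply: ge_sup => //; exists r1.
have h4 : r2 <= sup (log_ratios G (expR (- x))).
  by apply: ub_le_sup => //; eexists; exact: Lub.
by split; rewrite ler_norml; apply/andP; split; lra.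
Qed.

Lemma alpha_minE : alpha_min G = inf real_exponents.
Proof.
apply: cvg_lim => //; apply: cvg_along_expR => e e0.
by have [X HX] := log_ratios_extrema_near e0; exists X => x /HX[].
Qed.

Lemma alpha_maxE : alpha_max G = sup real_exponents.
Proof.
apply: cvg_lim => //; apply: cvg_along_expR => e e0.
by have [X HX] := log_ratios_extrema_near e0; exists X => x /HX[].
Qed.

(** Near an end of the interval an almost extreme exponent does; inside, two
    almost extreme exponents can be mixed. *)
Lemma real_exponents_dense a e : alpha_min G <= a <= alpha_max G -> 0 < e ->
  exists2 l, real_exponents l & `|l - a| <= e.
Proof.
rewrite alpha_minE alpha_maxE => /andP[ia as_] e0.
have Psup := has_sup_real_exponents; have [_ Pub] := Psup.
have Pinf := has_inf_real_exponents; have [_ Plb] := Pinf.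
have [l1 lP1 hl1] := inf_adherent e0 Pinf.
have [l2 lP2 hl2] := sup_adherent e0 Psup.
have := ge_inf Plb lP1; have := ub_le_sup Pub lP2 => h2 h1.
have [al1|l1a] := leP a l1.
  by exists l1 => //; rewrite ler_norml; apply/andP; split; lra.
have [l2a|al2] := leP l2 a.
  by exists l2 => //; rewrite ler_norml; apply/andP; split; lra.
by apply: (exponents_intermediate lP1 lP2) => //; rewrite l1a.
Qed.

Lemma real_exponents_itv l :
  real_exponents l -> alpha_min G <= l <= alpha_max G.
Proof.
move=> lP; rewrite alpha_minE alpha_maxE.
have [_ Plb] := has_inf_real_exponents; have [_ Pub] := has_sup_real_exponents.
by apply/andP; split; [exact: ge_inf|exact: ub_le_sup].
Qed.

End PeriodicPaths.

Unset Implicit Arguments.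

Theorem proposition2p13 (R : realType) (G : mpsystem R)
    (hG : irreducible_system G) :
  dense_in (periodic_exponents G)
    [set l : \bar R | ((alpha_min G)%:E <= l <= (alpha_max G)%:E)%E].
Proof.
move=> [a||] //= hl; last by case/andP: hl.
move=> U; rewrite /nbhs/= /ereal_nbhs/= => /nbhs_ballP[e /= e0 HU].
rewrite !lee_fin in hl.
have e20 : 0 < e / 2 by lra.
have [l lP le] := real_exponents_dense hG hl e20.
exists l%:E; split; last by apply: HU; rewrite /ball/= distrC; lra.
by split=> //=; rewrite !lee_fin; exact: real_exponents_itv.
Qed.
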